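(* Let $X$ be a Banach space and $A\subseteq X$ bounded and convex. If $a\in A$ satisfies that for every $\varepsilon>0$ there exists a convex combination $C$ of slices of $A$ such that $C\subseteq a+\varepsilon B_X$, then $a$ is an SCD point of $A$. In particular, strongly regular points and denting points are SCD points.
   Context: Banach spaces are over $\mathbb{K}=\mathbb{R}$ or $\mathbb{C}$; $B_X$ and $X^*$ denote the closed unit ball and the topological dual of $X$. A slice of a bounded set $A\subseteq X$ is a non-empty intersection of $A$ with an open half-space; it can be written as $S(A,x^*,\alpha)=\{x\in A:\operatorname{Re}x^*(x)>\sup_{b\in A}\operatorname{Re}x^*(b)-\alpha\}$ with $x^*\in X^*$, $\alpha>0$. A convex combination of slices of $A$ is a set of the form $\sum_{i=1}^n\lambda_iS_i$, where $n\in\mathbb{N}$, $S_1,\dots,S_n$ are slices of $A$, $\lambda_i\ge0$ and $\sum_{i=1}^n\lambda_i=1$. Let $A\subseteq X$ be bounded and convex and $a\in A$. A countable collection $\{V_n:n\in\mathbb{N}\}$ of non-empty subsets of $A$ is determining for $a$ if $a\in\overline{\mathrm{conv}}(B)$ whenever $B\subseteq A$ intersects all the sets $V_n$. The point $a$ is an SCD point (slicely countably determined point) of $A$ if there is a sequence of slices of $A$ that is determining for $a$. A point $a\in A$ is a denting point of the bounded convex set $A$ if for every $\varepsilon>0$ there is a slice $S$ of $A$ with $a\in S$ and $\mathrm{diam}(S)\le\varepsilon$. A point $a$ of a closed convex bounded set $A$ is a strongly regular point of $A$ if there exist convex combinations of slices of $A$ containing $a$ and having arbitrarily small diameter. *)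

(* Defs.v *)
From HB Require Import structures.
From mathcomp Require Import all_boot all_order all_algebra.
From mathcomp Require Import complex.
From mathcomp Require Import all_classical all_reals all_analysis.

Set Implicit Arguments.
Unset Strict Implicit.
Unset Printing Implicit Defensive.

Import Order.TTheory GRing.Theory Num.Theory.
Import numFieldNormedType.Exports.

Local Open Scope classical_set_scope.
Local Open Scope ring_scope.

Variant scalars := real_scalars | complex_scalars.

Definition scalar_field (R : realType) (s : scalars) : numFieldType :=
  match s with
  | real_scalars => R
  | complex_scalars => R[i]
  end.

Definition re (R : realType) (s : scalars) : scalar_field R s -> R :=
  match s return scalar_field R s -> R with
  | real_scalars => fun z => z
  | complex_scalars => fun z => complex.Re z
  end.

Definition of_real (R : realType) (s : scalars) : R -> scalar_field R s :=
  match s return R -> scalar_field R s with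
  | real_scalars => fun r => r
  | complex_scalars => fun r => Complex r 0
  end.

Section SCD.
Context {R : realType} {s : scalars}.
Local Notation K := (scalar_field R s).
Context {X : normedModType K}.
Implicit Types (A B C S : set X) (a x y : X).

Definition unit_ball : set X := [set x | `|x| <= 1].

(* a + eps B_X *)
Definition shifted_ball a (eps : R) : set X :=
  [set a + of_real s eps *: b | b in unit_ball].

(* The norm of X takes its values in K, hence the [re]. *)
Definition diam S : \bar R :=
  ereal_sup [set (re `|p.1 - p.2|)%:E | p in S `*` S].

(* [convex_set] quantifies over the t in K with 0 <= t <= 1; for the order of
   R[i] these are exactly the real numbers of the unit interval. *)
Definition conv_hull B : set X := smallest (@convex_set K X) B.

(* S(A, f, alpha); the real [sup] is meaningful only because A is nonempty and
   bounded (and f continuous) wherever slices are considered. *)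
Definition slice_of A (f : X -> K^o) (alpha : R) : set X :=
  [set x | A x /\ re (f x) > sup [set re (f b) | b in A] - alpha].

Definition is_slice A S : Prop :=
  S !=set0 /\
  exists (f : {linear X -> K^o}) (alpha : R),
    [/\ continuous f, 0 < alpha & S = slice_of A f alpha].

Definition is_convex_comb_slices A C : Prop :=
  exists (n : nat) (lambda : 'I_n -> R) (S : 'I_n -> set X),
    [/\ forall i, is_slice A (S i),
        forall i, 0 <= lambda i,
        \sum_(i < n) lambda i = 1 &
        C = [set \sum_(i < n) of_real s (lambda i) *: x i |
              x in [set x : 'I_n -> X | forall i, S i (x i)]]].

Definition determining A a (V : nat -> set X) : Prop :=
  (forall n, V n !=set0 /\ V n `<=` A) /\
  forall B, B `<=` A -> (forall n, B `&` V n !=set0) ->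
    closure (conv_hull B) a.

Definition scd_point A a : Prop :=
  A a /\
  exists V : nat -> set X, (forall n, is_slice A (V n)) /\ determining A a V.

Definition denting_point A a : Prop :=
  A a /\
  forall eps : R, 0 < eps ->
    exists S, [/\ is_slice A S, S a & (diam S <= eps%:E)%E].

Definition strongly_regular_point A a : Prop :=
  A a /\
  forall eps : R, 0 < eps ->
    exists C, [/\ is_convex_comb_slices A C, C a & (diam C <= eps%:E)%E].

End SCD.

(* Main.v *)
Require Import Defs.
From HB Require Import structures.
From mathcomp Require Import all_boot all_order all_algebra.
From mathcomp Require Import complex.
From mathcomp Require Import all_classical all_reals all_analysis.

Import Order.TTheory GRing.Theory Num.Theory.
Import numFieldNormedType.Exports.

Local Open Scope classical_set_scope.
Local Open Scope ring_scope.

(** The slices that witness the SCD property are all the slices occurring in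
    some choice of convex combinations C_m contained in the balls of radius
    1/(m+1) around a; since each combination is finite, there are countably
    many of them. If B meets every one of these slices, then picking a point
    of B in each slice of C_m and combining these points with the weights of
    C_m yields a point that lies both in the convex hull of B, as a convex
    combination of points of B ([convex_set_sum]), and in C_m, hence within
    1/(m+1) of a. So a is in the closure of the convex hull of B
    ([scd_point_small_comb]).

    A strongly regular point lies in combinations of slices of arbitrarily
    small diameter, and a set containing a of diameter at most eps is contained
    in a + eps B_X ([diam_le_shifted_ball]); so the criterion applies. A denting
    point is strongly regular, because a single slice is a convex combination
    of slices. *)

Section real_scalars_in_K.
Context {R : realType} {s : scalars}.
Local Notation K := (scalar_field R s).
Local Notation of_real := (@of_real R s).

(** For the order of R[i], nonnegative scalars are real; this turns norms, which
    take values in K, back into reals. *)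
Lemma of_real_re (z : K) : 0 <= z -> of_real (re z) = z.
Proof. by case: s z => //= z z0; exact/RRe_real/ger0_real. Qed.

Lemma of_real0 : of_real 0 = 0.
Proof. by case: s. Qed.

Lemma of_real1 : of_real 1 = 1.
Proof. by case: s. Qed.

Lemma ler_of_real : {mono of_real : x y / x <= y}.
Proof. by case: s => //= x y; exact: lecR. Qed.

Lemma ltr_of_real : {mono of_real : x y / x < y}.
Proof. by case: s => //= x y; exact: ltcR. Qed.

Lemma of_real_sum n (F : 'I_n -> R) :
  of_real (\sum_(i < n) F i) = \sum_(i < n) of_real (F i).
Proof. by case: s => //=; exact: (raddf_sum (real_complex R)). Qed.

End real_scalars_in_K.

(** Binary convexity suffices by induction: the first n terms, renormalised by
    their total weight t, form a convex combination y, and the whole sum is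
    t *: y + (1 - t) *: x_n. *)
Lemma convex_set_sum (K : numFieldType) (M : lmodType K) (B : set M) n
    (mu : 'I_n -> K) (x : 'I_n -> M) :
  convex_set B -> (forall i, 0 <= mu i) -> \sum_(i < n) mu i = 1 ->
  (forall i, B (x i)) -> B (\sum_(i < n) mu i *: x i).
Proof.
move=> cB; elim: n mu x => [|n IHn] mu x mu0 mu1 Bx.
  by move: mu1; rewrite big_ord0 => /esym/eqP; rewrite oner_eq0.
move: mu1; rewrite !big_ord_recr/=.
set t := \sum_(i < n) _; set m := mu ord_max => tm1.
have t_ge0 : 0 <= t by exact: sumr_ge0.
have mE : m = 1 - t by rewrite -tm1 addrAC subrr add0r.
(* If t = 0 no renormalisation is possible, but the sum is then x_n. *)
have [t0|t0] := eqVneq t 0.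
  have mu0n i : mu (widen_ord (leqnSn n) i) = 0.
    by have /psumr_eq0P := t0; exact.
  rewrite big1 => [|i _]; last by rewrite mu0n scale0r.
  by rewrite add0r mE t0 subr0 scale1r.
have t_le1 : t <= 1 by rewrite -tm1 lerDl; exact: mu0.
pose y := \sum_(i < n) (mu (widen_ord (leqnSn n) i) / t) *:
  x (widen_ord (leqnSn n) i).
have By : B y.
  apply: IHn => //= [i|]; first by rewrite divr_ge0.
  by rewrite -mulr_suml divff.
have := cB y (x ord_max) (Itv01 t_ge0 t_le1).
move=> /(_ (mem_set By) (mem_set (Bx _))) /set_mem /=.
suff -> : \sum_(i < n) mu (widen_ord (leqnSn n) i) *:
    x (widen_ord (leqnSn n) i) = t *: y by rewrite mE.
rewrite scaler_sumr; apply: eq_bigr => i _.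
by rewrite scalerA mulrCA divff// mulr1.
Qed.

Section scd_points.
Context {R : realType} {s : scalars}.
Local Notation K := (scalar_field R s).
Context {X : normedModType K}.
Implicit Types (A B C S : set X) (a x : X).

Lemma conv_hull_sum B n (lambda : 'I_n -> R) (x : 'I_n -> X) :
  (forall i, 0 <= lambda i) -> \sum_(i < n) lambda i = 1 ->
  (forall i, B (x i)) ->
  conv_hull B (\sum_(i < n) of_real s (lambda i) *: x i).
Proof.
move=> l0 l1 Bx D [cD BD]; apply: convex_set_sum => // [i||i].
- by rewrite -of_real0 ler_of_real.
- by rewrite -of_real_sum l1 of_real1.
- exact/BD/Bx.
Qed.

Lemma shifted_ballP a (eps : R) x : 0 < eps ->
  shifted_ball a eps x <-> `|x - a| <= of_real s eps.
Proof.
rewrite -(@ltr_of_real R s) of_real0 => e0; split=> [[b b1 <-]|xa].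
  rewrite addrAC subrr add0r normrZ gtr0_norm//.
  by rewrite -[leRHS]mulr1 ler_pM2l.
exists ((of_real s eps)^-1 *: (x - a)); last first.
  by rewrite scalerA divff ?gt_eqF// scale1r addrC subrK.
rewrite /unit_ball/= normrZ gtr0_norm ?invr_gt0//.
by rewrite mulrC ler_pdivrMr// mul1r.
Qed.

Lemma diam_le_shifted_ball C a (eps : R) : 0 < eps ->
  C a -> (diam C <= eps%:E)%E -> C `<=` shifted_ball a eps.
Proof.
move=> e0 Ca dC x Cx; apply/shifted_ballP => //.
rewrite -(of_real_re _ (normr_ge0 _)) ler_of_real -lee_fin.
by apply: le_trans dC; apply: ereal_sup_ubound; exists (x, a).
Qed.

Lemma closure_shifted_ball B a :
  (forall m : nat, B `&` shifted_ball a m.+1%:R^-1 !=set0) -> closure B a.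
Proof.
move=> Ba U /nbhs_ballP[e /= e0 eU].
have re0 : 0 < re e by rewrite -(@ltr_of_real R s) of_real0 of_real_re ?ltW.
have [m me] := ltr_add_invr re0.
have [x [Bx /shifted_ballP xa]] := Ba m.
exists x; split => //; apply: eU; rewrite -ball_normE/= distrC.
apply: le_lt_trans (xa _) _ => //.
by rewrite -(of_real_re _ (ltW e0)) ltr_of_real -[ltLHS]add0r.
Qed.

Lemma is_slice_convex_comb A S : is_slice A S -> is_convex_comb_slices A S.
Proof.
move=> AS; exists 1%N, (fun=> 1), (fun=> S); split => //.
  by rewrite big_ord1.
apply/seteqP; split=> [x Sx|_ [x /= Sx <-]].
  by exists (fun=> x) => //=; rewrite big_ord1 of_real1 scale1r.
by rewrite big_ord1 of_real1 scale1r.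
Qed.

Lemma denting_strongly_regular A a :
  denting_point A a -> strongly_regular_point A a.
Proof.
move=> [Aa dent]; split => // eps /dent[S [AS Sa dS]].
by exists S; split => //; exact: is_slice_convex_comb.
Qed.

(** Being determining does not depend on the enumeration, so the slices may be
    indexed by any nonempty countable type. *)
Lemma scd_point_countable (I : countType) (i0 : I) (W : I -> set X) A a :
  A a -> (forall i, is_slice A (W i)) ->
  (forall B, B `<=` A -> (forall i, B `&` W i !=set0) ->
    closure (conv_hull B) a) ->
  scd_point A a.
Proof.
move=> Aa AW det; split => //.
exists (fun k => W (odflt i0 (unpickle k))); split => //; split=> [k|B BA BW].
  have [W0 [f [alpha [_ _ WE]]]] := AW (odflt i0 (unpickle k)).
  by split => //; rewrite WE => x [].
by apply: det => // i; have := BW (pickle i); rewrite pickleK.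
Qed.

(** The sequence repeats a slice of C beyond the number of terms of C: with
    families indexed by nat, a choice for every eps is again a family with a
    simply typed index. *)
Lemma comb_slices_conv_hull A C D : is_convex_comb_slices A C -> C `<=` D ->
  exists V : nat -> set X, (forall k, is_slice A (V k)) /\
    forall B, (forall k, B `&` V k !=set0) -> conv_hull B `&` D !=set0.
Proof.
move=> [n [lambda [S [AS l0 l1 ->]]]] CD.
(* The weights sum to 1, so there is at least one term. *)
have i0 : 'I_n.
  case: n {S AS l0 CD} lambda l1 => [lambda|n _ _]; last exact: ord0.
  by rewrite big_ord0 => /esym/eqP; rewrite oner_eq0.
exists (fun k => S (insubd i0 k)); split=> // B BS.
have /choice[x BSx] (i : 'I_n) : exists y, (B `&` S i) y.
  by have := BS i; rewrite valKd.
exists (\sum_(i < n) of_real s (lambda i) *: x i); split.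
  by apply: conv_hull_sum => // i; case: (BSx i).
by apply: CD; exists x => // i; case: (BSx i).
Qed.

(** Approximating a by convex combinations of slices within 1/(m+1), for every
    m, involves only countably many slices; together they are determining. *)
Lemma scd_point_small_comb A a : A a ->
  (forall eps : R, 0 < eps ->
    exists C, is_convex_comb_slices A C /\ C `<=` shifted_ball a eps) ->
  scd_point A a.
Proof.
move=> Aa small.
have /choice[V AV] (m : nat) : exists V : nat -> set X,
    (forall k, is_slice A (V k)) /\ forall B, (forall k, B `&` V k !=set0) ->
      conv_hull B `&` shifted_ball a m.+1%:R^-1 !=set0.
  have [|C [AC Ca]] := small m.+1%:R^-1; first by rewrite invr_gt0.
  exact: comb_slices_conv_hull AC Ca.
apply: (@scd_point_countable _ (0, 0)%N (fun p => V p.1 p.2)) => //.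
  by move=> [m k]; case: (AV m).
move=> B _ BV; apply: closure_shifted_ball => m.
by case: (AV m) => _; apply=> k; exact: (BV (m, k)).
Qed.

Lemma strongly_regular_scd A a : strongly_regular_point A a -> scd_point A a.
Proof.
move=> [Aa reg]; apply: scd_point_small_comb => // eps e0.
have [C [AC Ca dC]] := reg eps e0.
by exists C; split => //; exact: diam_le_shifted_ball.
Qed.

End scd_points.

Theorem proposition2p16 (R : realType) (s : scalars)
    (X : completeNormedModType (scalar_field R s)) (A : set X)
    (A_bounded : bounded_set A) (A_convex : convex_set A) :
  [/\ forall a : X, A a ->
        (forall eps : R, 0 < eps ->
           exists C : set X,
             is_convex_comb_slices A C /\ C `<=` shifted_ball a eps) ->
        scd_point A a,
      closed A -> forall a : X, strongly_regular_point A a -> scd_point A a &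
      forall a : X, denting_point A a -> scd_point A a].
Proof.
split=> [a|_ a|a /denting_strongly_regular].
- exact: scd_point_small_comb.
- exact: strongly_regular_scd.
- exact: strongly_regular_scd.
Qed.
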